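(* Let $\phi\in L^2(\mathbb{R})$ be real-valued. Then the map \[ L^2(\mathbb{R})/\!\sim\ \ni f\mapsto (|\mathcal{W}_\phi f(b,a)|)_{(b,a)\in\mathbb{R}\times\mathbb{R}_+} \] is not injective.
   Context: $\mathbb{R}_+=(0,+\infty)$ and $L^2(\mathbb{R})$ is the space of complex-valued square-integrable functions on $\mathbb{R}$. For $f,g\in L^2(\mathbb{R})$, $f\sim g$ if and only if $f=e^{i\alpha}g$ for some $\alpha\in\mathbb{R}$. The wavelet transform is \[ \mathcal{W}_{\phi}f(b,a)=a^{-1/2}\int_{\mathbb{R}} f(x)\,\overline{\phi\left(\frac{x-b}{a}\right)}\,dx,\qquad b\in\mathbb{R},\ a\in\mathbb{R}_+. \] The map is well defined on equivalence classes. *)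

(* Defs.v *)
From HB Require Import structures.
From mathcomp Require Import all_boot all_order all_algebra.
From mathcomp Require Import all_classical all_reals all_analysis.
From mathcomp Require Import measurable_realfun complex ring.

Set Implicit Arguments.
Unset Strict Implicit.
Unset Printing Implicit Defensive.

Import Order.TTheory GRing.Theory Num.Theory.
Import numFieldNormedType.Exports.

Local Open Scope classical_set_scope.
Local Open Scope ring_scope.
Local Open Scope complex_scope.
Local Open Scope quotient_scope.

Section ComplexL2.
Variable R : realType.
Local Notation mu := (@lebesgue_measure R).
Local Notation normc := ComplexField.Normc.normc.

#[local] Instance ae_lebesgue_filter : Filter (nbhs (almost_everywhere mu)).
Proof. exact: (ae_filter_ringOfSetsType mu). Qed.

(* Measurability of a complex-valued function is measurability of its real and
   imaginary parts. *)
Definition square_integrable (f : R -> R[i]) : Prop :=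
  [/\ measurable_fun setT (fun x => complex.Re (f x)),
      measurable_fun setT (fun x => complex.Im (f x)) &
      finite_norm mu 2%:E (fun x => normc (f x))].

Record l2fun := L2Fun {
  l2fun_val :> R -> R[i];
  l2funP : square_integrable l2fun_val }.

HB.instance Definition _ := gen_eqMixin l2fun.
HB.instance Definition _ := gen_choiceMixin l2fun.

Definition l2fun_ae_eq (f g : l2fun) : bool :=
  `[< {ae mu, forall x, f x = g x} >].

Lemma l2fun_ae_eq_refl : reflexive l2fun_ae_eq.
Proof. by move=> f; apply/asboolP; apply: nearW. Qed.

Lemma l2fun_ae_eq_sym : symmetric l2fun_ae_eq.
Proof.
by move=> f g; apply/idP/idP => /asboolP fg; apply/asboolP;
  apply: filterS fg => x ->.
Qed.

Lemma l2fun_ae_eq_trans : transitive l2fun_ae_eq.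
Proof.
move=> g f h /asboolP fg /asboolP gh; apply/asboolP.
by apply: filterS2 fg gh => x -> ->.
Qed.

Canonical l2fun_ae_eq_equiv :=
  EquivRel l2fun_ae_eq l2fun_ae_eq_refl l2fun_ae_eq_sym l2fun_ae_eq_trans.

(* L^2(R): square-integrable functions modulo equality almost everywhere. *)
Definition L2 : Type := {eq_quot l2fun_ae_eq}.
HB.instance Definition _ := Choice.on L2.
HB.instance Definition _ := EqQuotient.on L2.

(* An element of L2 is applied to a point through a chosen representative. *)
Definition L2_to_fun (f : L2) : R -> R[i] := repr f.
Coercion L2_to_fun : L2 >-> Funclass.

Definition real_valued (f : L2) : Prop :=
  {ae mu, forall x, complex.Im (f x) = 0}.

Definition expi (alpha : R) : R[i] := cos alpha +i* sin alpha.

(* Equality in L^2(R) of f and e^{i alpha} g. *)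
Definition phase_equiv (f g : L2) : Prop :=
  exists alpha : R, {ae mu, forall x, f x = expi alpha * g x}.

Lemma expiD (s t : R) : expi (s + t) = expi s * expi t.
Proof.
rewrite /expi cosD sinD; apply/eqP; rewrite eq_complex /= eqxx /=.
by rewrite addrC [sin s * _]mulrC; apply/eqP; congr (_ + _); rewrite mulrC.
Qed.

Lemma expi0 : expi 0 = 1.
Proof. by rewrite /expi cos0 sin0. Qed.

Definition phase_eqb (f g : L2) : bool := `[< phase_equiv f g >].

Lemma phase_eqb_refl : reflexive phase_eqb.
Proof.
move=> f; apply/asboolP; exists 0.
by apply: nearW => x; rewrite expi0 mul1r.
Qed.

Lemma phase_eqb_sym : symmetric phase_eqb.
Proof.
suff H f g : phase_eqb f g -> phase_eqb g f by move=> f g; apply/idP/idP; exact: H.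
move=> /asboolP[a fg]; apply/asboolP; exists (- a).
by apply: filterS fg => x ->; rewrite mulrA -expiD addNr expi0 mul1r.
Qed.

Lemma phase_eqb_trans : transitive phase_eqb.
Proof.
move=> g f h /asboolP[a fg] /asboolP[b gh]; apply/asboolP; exists (a + b).
by apply: filterS2 fg gh => x -> ->; rewrite mulrA -expiD.
Qed.

Canonical phase_eqb_equiv :=
  EquivRel phase_eqb phase_eqb_refl phase_eqb_sym phase_eqb_trans.

Definition L2_phase : Type := {eq_quot phase_eqb}.
HB.instance Definition _ := Choice.on L2_phase.
HB.instance Definition _ := EqQuotient.on L2_phase.

(* The library's integral is real-valued; the complex one is taken
   componentwise. *)
Definition cintegral (f : R -> R[i]) : R[i] :=
  (\int[mu]_x complex.Re (f x)) +i* (\int[mu]_x complex.Im (f x)).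

Definition wavelet (phi f : R -> R[i]) (b : R) (a : {posnum R}) : R[i] :=
  (a%:num `^ (- 2^-1))%:C *
  cintegral (fun x => f x * (phi ((x - b) / a%:num))^*).

(* Evaluated on a representative of the class; wavelet_modulus_pi below shows
   that the value does not depend on the representatives of F or of phi. *)
Definition wavelet_modulus (phi : L2) (F : L2_phase)
    (p : R * {posnum R}) : R[i] := `|wavelet phi (repr F) p.1 p.2|.

Lemma measurable_affine (b : R) (a : {posnum R}) :
  measurable_fun setT (fun x : measurableTypeR R => (x - b) / a%:num : measurableTypeR R).
Proof. by apply: measurable_funM => //; apply: measurable_funB. Qed.

Lemma lebesgue_measure_affine (b : R) (a : {posnum R}) (A : set R) :
  measurable A ->
  (mu ((fun x => (x - b) / a%:num)%R @^-1` A) = a%:num%:E * mu A)%E.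
Proof.
move=> mA.
pose F := fun x : measurableTypeR R => (x - b) / a%:num : measurableTypeR R.
have mF : measurable_fun setT F := measurable_affine b a.
have k0 : 0 <= a%:num^-1 by rewrite invr_ge0.
pose k := NngNum k0.
pose nu m : {measure set (measurableTypeR R) -> \bar R} :=
  mscale k (measure_function_pushforward__canonical__measure_function_Measure mu (f:=F) m).
have nuE X : nu mF X = (a%:num^-1%:E * mu (F @^-1` X))%E by [].
suff muE : forall X, ocitv X -> mu X = nu mF X.
  have -> : mu A = nu mF A by exact: (lebesgue_measure_unique muE).
  by rewrite nuE muleA -EFinM divff ?mul1e.
move=> _ [[c d]] _ <-; rewrite nuE /=.
have -> : F @^-1` `]c, d] = `]c * a%:num + b, d * a%:num + b]%classic.
  apply/seteqP; split=> x /=; rewrite !in_itv/= /F ltr_pdivlMr// ler_pdivrMr// ltrBrDr lerBlDr//.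
rewrite !lebesgue_measure_itv/= !lte_fin ltrD2r ltr_pM2r//.
case: ifPn => _; last by rewrite mule0.
rewrite -!EFinD -EFinM; congr (_%:E).
by field.
Qed.

Lemma ge0_integral_affine (b : R) (a : {posnum R}) (h : R -> \bar R) :
  measurable_fun setT h -> (forall x, 0 <= h x)%E ->
  (\int[mu]_x h ((x - b) / a%:num)%R = a%:num%:E * \int[mu]_x h x)%E.
Proof.
move=> mh h0.
pose F := fun x : measurableTypeR R => (x - b) / a%:num : measurableTypeR R.
have mF : measurable_fun setT F := measurable_affine b a.
have := @ge0_integral_pushforward _ _ _ _ R F mF mu setT h measurableT mh (fun y _ => h0 y).
rewrite preimage_setT => <-.
have k0 : 0 <= a%:num by [].
pose k := NngNum k0.
rewrite -(@ge0_integral_mscale _ _ R mu setT measurableT k)//.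
apply: eq_measure_integral => A mA _.
exact: lebesgue_measure_affine.
Qed.

Lemma normr_Re_le (z : R[i]) : `|complex.Re z| <= normc z.
Proof. by have := normc_ge_Re z; rewrite -lecR. Qed.

Lemma normr_Im_le (z : R[i]) : `|complex.Im z| <= normc z.
Proof.
by case: z => x y; rewrite /= -sqrtr_sqr ler_wsqrtr// lerDr sqr_ge0.
Qed.

Lemma measurable_normc (f : R -> R[i]) :
  measurable_fun setT (fun x => complex.Re (f x)) ->
  measurable_fun setT (fun x => complex.Im (f x)) ->
  measurable_fun setT (fun x => normc (f x)).
Proof.
move=> mR mI.
have nE z : normc z = (complex.Re z ^+ 2 + complex.Im z ^+ 2) `^ 2^-1.
  by rewrite powR12_sqrt ?addr_ge0 ?sqr_ge0//; case: z.
under eq_fun do rewrite nE.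
apply: (@measurableT_comp _ _ _ _ _ _ (@powR R ^~ 2^-1)) => //.
by apply: measurable_funD; exact: measurable_funX.
Qed.

Lemma finite_norm2_le (f g : R -> R) : measurable_fun setT f ->
  measurable_fun setT g -> (forall x, `|f x| <= `|g x|) ->
  finite_norm mu 2%:E g -> finite_norm mu 2%:E f.
Proof.
move=> mf mg fg; rewrite /finite_norm; apply: le_lt_trans.
rewrite unlock gt0_ler_poweR//.
- by rewrite in_itv/= leey integral_ge0// => x _; exact: poweR_ge0.
- by rewrite in_itv/= leey integral_ge0// => x _; exact: poweR_ge0.
apply: ge0_le_integral => //=.
- apply/measurable_EFinP.
  apply/(@measurableT_comp _ _ _ _ _ _ (fun x : R => x `^ 2)%R) => //.
  exact/measurableT_comp.
- apply/measurable_EFinP.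
  apply/(@measurableT_comp _ _ _ _ _ _ (fun x : R => x `^ 2)%R) => //.
  exact/measurableT_comp.
- by move=> x _; rewrite lee_fin ge0_ler_powR// nnegrE.
Qed.

Lemma square_integrable_Lfun (f : R -> R[i]) : square_integrable f ->
  (fun x => complex.Re (f x)) \in Lfun mu 2%:E /\
  (fun x => complex.Im (f x)) \in Lfun mu 2%:E.
Proof.
move=> [mR mI fin]; have mn := measurable_normc mR mI.
have le (g : R -> R) : measurable_fun setT g -> (forall x, `|g x| <= normc (f x)) ->
    g \in Lfun mu 2%:E.
  move=> mg gn; rewrite inE; apply/andP; split; rewrite inE//=.
  apply: finite_norm2_le fin => // x.
  exact: le_trans (gn x) (ler_norm _).
by split; apply: le => // x; [exact: normr_Re_le|exact: normr_Im_le].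
Qed.

Lemma square_integrable_affine (f : R -> R[i]) (b : R) (a : {posnum R}) :
  square_integrable f -> square_integrable (fun x => f ((x - b) / a%:num)).
Proof.
move=> [mR mI fin]; split.
- exact: (measurableT_comp mR (measurable_affine b a)).
- exact: (measurableT_comp mI (measurable_affine b a)).
have mn := measurable_normc mR mI.
move: fin; rewrite /finite_norm unlock /=.
rewrite (@ge0_integral_affine b a (fun x => `|(normc (f x))%:E| `^ 2)%E); last 2 first.
- apply/measurable_EFinP.
  apply/(@measurableT_comp _ _ _ _ _ _ (fun x : R => x `^ 2)%R) => //.
  exact/measurableT_comp.
- by move=> x; exact: poweR_ge0.
move=> fin.
have : (\int[mu]_x (`|(normc (f x))%:E| `^ 2) < +oo)%E.
  by apply: (@lty_poweRy _ _ 2^-1).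
move=> h.
apply: poweR_lty.
by rewrite lte_mul_pinfty.
Qed.

Lemma ae_affine (P : set R) (b : R) (a : {posnum R}) :
  {ae mu, forall x, P x} -> {ae mu, forall x, P ((x - b) / a%:num)}.
Proof.
move=> [N [mN N0 PN]]; exists ((fun x => (x - b) / a%:num) @^-1` N); split.
- by rewrite -[X in measurable X]setTI; exact: (measurable_affine b a).
- have := lebesgue_measure_affine b a mN.
  by move=> /= ->; rewrite N0 mule0.
- by move=> x /= Px; exact: PN.
Qed.

Lemma wavelet_integrable (phi f : R -> R[i]) (b : R) (a : {posnum R}) :
  square_integrable phi -> square_integrable f ->
  let h x := f x * (phi ((x - b) / a%:num))^* in
  mu.-integrable setT (EFin \o (fun x => complex.Re (h x))) /\
  mu.-integrable setT (EFin \o (fun x => complex.Im (h x))).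
Proof.
move=> /(square_integrable_affine b a)/square_integrable_Lfun[pR pI].
move=> /square_integrable_Lfun[fR fI] h.
have int u v : u \in Lfun mu 2%:E -> v \in Lfun mu 2%:E ->
    mu.-integrable setT (EFin \o (u \* v)).
  by move=> ul vl; apply/Lfun1_integrable; exact: Lfun2_mul_Lfun1.
split.
- apply: eq_integrable (integrableD measurableT (int _ _ fR pR) (int _ _ fI pI)) => //.
  by move=> x _ /=; rewrite /h; case: (f x) (phi _) => [u v] [s t] /=; rewrite mulrN opprK.
- apply: eq_integrable (integrableB measurableT (int _ _ fI pR) (int _ _ fR pI)) => //.
  move=> x _ /=; rewrite /h; case: (f x) (phi _) => [u v] [s t] /=.
  by rewrite -EFinB; congr (_%:E); ring.
Qed.

Lemma Rintegral_ae_eq (f g : R -> R) :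
  mu.-integrable setT (EFin \o f) -> mu.-integrable setT (EFin \o g) ->
  {ae mu, forall x, f x = g x} ->
  \int[mu]_x f x = \int[mu]_x g x.
Proof.
move=> /measurable_int mf /measurable_int mg fg; congr fine.
by apply: ae_eq_integral => //; apply: filterS fg => x /= ->.
Qed.

Lemma wavelet_ae_phase (phi phi' f g : l2fun) (alpha b : R) (a : {posnum R}) :
  {ae mu, forall x, phi x = phi' x} ->
  {ae mu, forall x, f x = expi alpha * g x} ->
  wavelet phi f b a = expi alpha * wavelet phi' g b a.
Proof.
move=> /(ae_affine b a) pp fg; rewrite /wavelet mulrCA; congr (_ * _).
rewrite /cintegral.
have [fR fI] := wavelet_integrable b a (l2funP phi) (l2funP f).
have [gR gI] := wavelet_integrable b a (l2funP phi') (l2funP g).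
have scal (u : R -> R) c : mu.-integrable setT (EFin \o u) ->
   mu.-integrable setT (EFin \o (fun x => c * u x)).
  by move=> /(integrableZl measurableT c).
apply/eqP; rewrite eq_complex /=; apply/andP; split; apply/eqP.
- rewrite -!RintegralZl// -RintegralB//; [|exact: scal|exact: scal].
  apply: Rintegral_ae_eq => //.
    have := integrableB measurableT (scal _ (cos alpha) gR) (scal _ (sin alpha) gI).
    exact: eq_integrable.
  apply: filterS2 pp fg => x -> ->; rewrite -mulrA.
  by case: (_ * _^*)%R => u v.
- rewrite -!RintegralZl// -RintegralD//; [|exact: scal|exact: scal].
  apply: Rintegral_ae_eq => //.
    have := integrableD measurableT (scal _ (cos alpha) gI) (scal _ (sin alpha) gR).
    exact: eq_integrable.
  apply: filterS2 pp fg => x -> ->; rewrite -mulrA.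
  by case: (_ * _^*)%R => u v.
Qed.

Lemma norm_expi (alpha : R) : `|expi alpha| = 1.
Proof. by rewrite normc_def /= cos2Dsin2 sqrtr1. Qed.

Lemma repr_pi_L2 (f : l2fun) : {ae mu, forall x, (\pi_(L2) f : L2) x = f x}.
Proof. by have /eqmodP/asboolP := reprK (\pi_(L2) f). Qed.

Lemma repr_pi_L2_phase (f : L2) : phase_equiv (repr (\pi_(L2_phase) f)) f.
Proof. by have /eqmodP/asboolP := reprK (\pi_(L2_phase) f). Qed.

Lemma wavelet_modulus_pi (phi f : l2fun) (p : R * {posnum R}) :
  wavelet_modulus (\pi_(L2) phi) (\pi_(L2_phase) (\pi_(L2) f)) p =
  `|wavelet phi f p.1 p.2|.
Proof.
have [alpha fa] := repr_pi_L2_phase (\pi_(L2) f).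
rewrite /wavelet_modulus.
have -> : wavelet (\pi_(L2) phi : L2) (repr (\pi_(L2_phase) (\pi_(L2) f)) : L2) p.1 p.2
    = expi alpha * wavelet phi f p.1 p.2; last by rewrite normrM norm_expi mul1r.
apply: wavelet_ae_phase; first exact: repr_pi_L2.
by apply: filterS2 fa (repr_pi_L2 f) => x fE <-; exact: fE.
Qed.

End ComplexL2.

(* Main.v *)
Require Import Defs.
From mathcomp Require Import all_boot all_order all_algebra.
From mathcomp Require Import all_classical all_reals all_analysis.
From mathcomp Require Import measurable_realfun complex ring.

(** A real wavelet cannot tell a signal from its complex conjugate: when [phi]
    is real almost everywhere, conjugation passes through the integral, so the
    transform of the conjugate of [f] is the conjugate of the transform of [f]
    ([wavelet_conj]) and both have the same modulus.  It remains to choose an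
    [f] that is not a unimodular multiple of its conjugate.  Such a multiple
    forces the argument of [f] to be constant modulo pi, so a function equal to
    1 on one set of positive measure and to i on another one will do
    ([step_not_phase_equiv_conj]). *)

Set Implicit Arguments.
Unset Strict Implicit.
Unset Printing Implicit Defensive.

Import Order.TTheory GRing.Theory Num.Theory.

Local Open Scope classical_set_scope.
Local Open Scope ring_scope.
Local Open Scope complex_scope.
Local Open Scope quotient_scope.

#[local] Instance ae_lebesgue_filter (R : realType) :
  Filter (nbhs (almost_everywhere (@lebesgue_measure R))).
Proof. exact: ae_filter_ringOfSetsType. Qed.

Section Conjugation.
Variable R : realType.
Local Notation mu := (@lebesgue_measure R).

Lemma square_integrable_conj (f : R -> R[i]) :
  square_integrable f -> square_integrable (fun x => (f x)^*).
Proof.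
move=> [mR mI fin]; split.
- by apply: eq_measurable_fun mR => x _; case: (f x).
- apply: (@eq_measurable_fun _ _ _ _ _ (fun x => - complex.Im (f x))).
    by move=> x _; case: (f x).
  exact: measurableT_comp.
- suff -> : (fun x => ComplexField.Normc.normc (f x)^*) =
            (fun x => ComplexField.Normc.normc (f x)) by [].
  by apply/funext => x; case: (f x) => u v /=; rewrite sqrrN.
Qed.

Definition l2conj (f : l2fun R) : l2fun R :=
  L2Fun (square_integrable_conj (l2funP f)).

(** The conjugate of the integrand for [f] is the integrand for the conjugate
    of [f], except on the null set where [phi ((x - b) / a)] is not real. *)
Lemma wavelet_conj (phi f : l2fun R) (b : R) (a : {posnum R}) :
  {ae mu, forall x, complex.Im (phi x) = 0} ->
  wavelet phi (l2conj f) b a = (wavelet phi f b a)^*.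
Proof.
move=> /(ae_affine b a) phi_real.
rewrite /wavelet rmorphM [X in _ = X * _]conjc_real; congr (_ * _).
have [fR fI] := wavelet_integrable b a (l2funP phi) (l2funP f).
have [gR gI] := wavelet_integrable b a (l2funP phi) (l2funP (l2conj f)).
have conj_ae : {ae mu, forall x,
    l2conj f x * (phi ((x - b) / a%:num))^* =
    (f x * (phi ((x - b) / a%:num))^*)^*}.
  apply: filterS phi_real => x; rewrite rmorphM /=.
  by case: (phi _) => u v /= ->; congr (_ * _); apply/eqP; rewrite eq_complex /= !oppr0 !eqxx.
rewrite /cintegral; apply/eqP; rewrite eq_complex /=.
apply/andP; split; apply/eqP.
- apply: Rintegral_ae_eq => //.
  by apply: filterS conj_ae => x ->; case: (_ * _).
- rewrite -mulN1r -RintegralZl //; apply: Rintegral_ae_eq => //.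
    exact: (integrableZl measurableT (-1) fI).
  by apply: filterS conj_ae => x ->; rewrite mulN1r; case: (_ * _).
Qed.

Lemma ae_witness (A P : set R) :
  (0 < mu A)%E -> {ae mu, forall x, P x} -> exists2 x, A x & P x.
Proof.
move=> A_gt0 [N [mN N0 PN]]; apply: contrapT => noAP.
have AN : A `<=` N.
  by move=> x Ax; apply: PN => Px; apply: noAP; exists x.
have := le_outer_measure mu _ _ AN.
by move=> /(lt_le_trans A_gt0); rewrite [X in (_ < X)%E]N0 ltxx.
Qed.

Definition step (A B : set R) (x : R) : R[i] := \1_A x +i* \1_B x.

Lemma square_integrable_step (A B : set R) :
  measurable A -> measurable B -> (mu A < +oo)%E -> (mu B < +oo)%E ->
  square_integrable (step A B).
Proof.
move=> mA mB Aoo Boo; split; [exact: measurable_indic..|].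
set n := fun x => _; rewrite /finite_norm unlock /=; apply: poweR_lty.
(* The two indicators take the values 0 and 1, so their squares are
   themselves. *)
have sqE x : `|n x| `^ 2 = \1_A x + \1_B x.
  rewrite /n /= ger0_norm ?sqrtr_ge0// powR_mulrn ?sqrtr_ge0//.
  rewrite sqr_sqrtr ?addr_ge0 ?sqr_ge0// !indicE.
  by do 2 case: (_ \in _); rewrite /= ?expr1n ?expr0n.
under eq_integral do rewrite sqE EFinD.
rewrite ge0_integralD //=; [|by apply/measurable_EFinP; exact: measurable_indic..].
by rewrite !integral_indic// !setIT lte_add_pinfty.
Qed.

(** A point of [A] outside [B] forces the phase factor to be 1, and a point of
    [B] outside [A] forces it to be -1. *)
Lemma step_not_phase_equiv_conj (A B : set R) (alpha : R) :
  [disjoint A & B] -> (0 < mu A)%E -> (0 < mu B)%E ->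
  ~ {ae mu, forall x, step A B x = expi alpha * (step A B x)^*}.
Proof.
move=> /disj_set2P AB0 A_gt0 B_gt0 fE.
have [x Ax] := ae_witness A_gt0 fE.
have [y By] := ae_witness B_gt0 fE.
have nBx : ~ B x by move=> Bx; have : (A `&` B) x by []; rewrite AB0.
have nAy : ~ A y by move=> Ay; have : (A `&` B) y by []; rewrite AB0.
rewrite /step !indicE !(mem_set Ax, mem_set By, memNset nBx, memNset nAy) /=.
move=> -[_ cosN1] -[cos1 _]; move: cosN1 cos1.
rewrite oppr0 !mulr0 subr0 addr0 mulrN1 mulr1 => cosN1 cos1.
by move/eqP: cosN1; rewrite -cos1 -subr_eq0 opprK -mulr2n pnatr_eq0.
Qed.

End Conjugation.

Theorem mainTheorem3 (R : realType) (phi : L2 R) (hphi : real_valued phi) :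
  ~ injective (wavelet_modulus phi).
Proof.
move=> phi_inj.
pose A := `[0, 1]%classic : set R; pose B := `[2, 3]%classic : set R.
have muA : lebesgue_measure A = 1%E.
  by rewrite lebesgue_measure_itv /= lte_fin ltr01 oppr0 adde0.
have muB : lebesgue_measure B = 1%E.
  rewrite lebesgue_measure_itv /= lte_fin ltr_nat /= -EFinB.
  by congr (_%:E); ring.
have AB0 : [disjoint A & B].
  apply/disj_set2P/seteqP; split=> // x []; rewrite /A /B /= !in_itv /=.
  by move=> /andP[_ x1] /andP[x2 _]; have := le_trans x2 x1; rewrite leNgt ltr1n.
have f2 : square_integrable (step A B).
  by apply: square_integrable_step; rewrite ?muA ?muB ?ltry //; exact: measurable_itv.
pose f := L2Fun f2.
have same_class : \pi_(L2_phase R) (\pi_(L2 R) (l2conj f)) =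
                  \pi_(L2_phase R) (\pi_(L2 R) f).
  (* [wavelet_modulus_pi] takes the modulus at the class of a function, so
     [phi] is written as the class of its representative. *)
  apply: phi_inj; apply/funext => p; rewrite -[phi]reprK !wavelet_modulus_pi.
  by rewrite wavelet_conj // normcJ.
have /eqmodP/asboolP[alpha fE] := esym same_class.
apply: (@step_not_phase_equiv_conj _ A B alpha) => //.
- by rewrite muA.
- by rewrite muB.
apply: filterS3 (repr_pi_L2 f) (repr_pi_L2 (l2conj f)) fE => x fx fcx.
rewrite fx fcx; exact.
Qed.
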